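(* Let $L$ be the Virasoro algebra $Vir$ or the W-algebra $W(2,2)$. Then any commutative post-Lie algebra structure on $L$ is trivial; namely, if $\cdot$ is a commutative post-Lie algebra structure on $L$, then $x\cdot y=0$ for all $x,y\in L$.
   Context: All vector spaces are over $\mathbb{C}$. The Virasoro algebra $Vir$ is the complex Lie algebra with basis $\{L_m, c \mid m\in\mathbb{Z}\}$ and Lie brackets $$[L_m,L_n]=(m-n)L_{m+n}+\tfrac{m^3-m}{12}\delta_{m+n,0}\,c,\quad [Vir,c]=0$$ for all $m,n\in\mathbb{Z}$. The W-algebra $W(2,2)$ is the complex Lie algebra with basis $\{L_m, H_m, c \mid m\in\mathbb{Z}\}$ and Lie brackets $$[L_m,L_n]=(m-n)L_{m+n}+\tfrac{m^3-m}{12}\delta_{m+n,0}\,c,\quad [L_m,H_n]=(m-n)H_{m+n}+\tfrac{m^3-m}{12}\delta_{m+n,0}\,c,\quad [H_m,H_n]=0,\quad [W(2,2),c]=0$$ for all $m,n\in\mathbb{Z}$ (the same central element $c$ appears in both the first and second brackets). A commutative post-Lie algebra structure on a complex Lie algebra $(L,[\,,])$ is a $\mathbb{C}$-bilinear product $x\cdot y$ on $L$ satisfying, for all $x,y,z\in L$: (i) $x\cdot y=y\cdot x$; (ii) $[x,y]\cdot z=x\cdot(y\cdot z)-y\cdot(x\cdot z)$; (iii) $x\cdot[y,z]=[x\cdot y,z]+[y,x\cdot z]$. *)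

(* Defs.v *)
From HB Require Import structures.
From mathcomp Require Import all_boot all_order all_algebra.
From mathcomp Require Import finmap monalg complex.
From mathcomp Require Import reals.
From mathcomp Require Import ring.

Set Implicit Arguments.
Unset Strict Implicit.
Unset Printing Implicit Defensive.

Import Order.TTheory GRing.Theory Num.Theory.
Local Open Scope ring_scope.

HB.mixin Record Lmodule_isLie (K : fieldType) L of GRing.Lmodule K L := {
  lie : L -> L -> L;
  lie_linearl : forall z, linear (lie^~ z);
  lie_linearr : forall z, linear (lie z);
  liexx : forall x, lie x x = 0;
  lie_jacobi : forall x y z,
    lie x (lie y z) + lie y (lie z x) + lie z (lie x y) = 0
}.

#[short(type="lieAlgType")]
HB.structure Definition LieAlgebra (K : fieldType) :=
  { L of GRing.Lmodule K L & Lmodule_isLie K L }.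

Notation "[ 'lie' x , y ]" := (lie x y)
  (at level 0, x, y at level 99, format "[ 'lie'  x ,  y ]") : ring_scope.

HB.instance Definition _ (K : fieldType) (L : lieAlgType K) :=
  bilinear_isBilinear.Build K L L L *:%R *:%R (@lie K L)
    (@lie_linearl K L, @lie_linearr K L).

Record comm_post_lie (K : fieldType) (L : lieAlgType K)
    (dot : {bilinear L -> L -> L}) : Prop := CommPostLie {
  cplC : forall x y, dot x y = dot y x;
  cpl_liel : forall x y z,
    dot [lie x, y] z = dot x (dot y z) - dot y (dot x z);
  cpl_lier : forall x y z,
    dot x [lie y, z] = [lie dot x y, z] + [lie y, dot x z]
}.

Section LinearExtension.
Variables (K : fieldType) (I : choiceType) (V : lmodType K).
Implicit Types (f : I -> V) (x : {malg K[I]}).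

Definition lin_ext f x : V := \sum_(i <- msupp x) x@_i *: f i.

Lemma lin_extEw (d : {fset I}) f x : (msupp x `<=` d)%fset ->
  lin_ext f x = \sum_(i <- d) x@_i *: f i.
Proof.
move=> le_xd; rewrite /lin_ext (big_fset_incl _ le_xd) // => i _ xi.
by rewrite mcoeff_outdom // scale0r.
Qed.

Lemma lin_ext_is_linear f : linear (lin_ext f).
Proof.
move=> a x y; pose d := (msupp (a *: x + y) `|` msupp x `|` msupp y)%fset.
rewrite !(@lin_extEw d) /d ?fsubsetUr //; last 2 first.
- by rewrite fsubsetU // fsubsetUr.
- by rewrite -fsetUA fsubsetUl.
rewrite scaler_sumr -big_split /=; apply: eq_bigr => i _.
by rewrite mcoeffD mcoeffZ scalerDl scalerA.
Qed.

HB.instance Definition _ f :=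
  GRing.isLinear.Build K {malg K[I]} V *:%R (lin_ext f) (lin_ext_is_linear f).

Lemma lin_extU f a i : lin_ext f << a *g i >> = a *: f i.
Proof.
by rewrite (lin_extEw _ msuppU_le) big_seq_fset1 mcoeffUU.
Qed.

Lemma eq_lin_ext f g : f =1 g -> lin_ext f =1 lin_ext g.
Proof. by move=> fg x; apply: eq_bigr => i _; rewrite fg. Qed.

Lemma lin_ext_comb a f g x :
  lin_ext (fun i => a *: f i + g i) x = a *: lin_ext f x + lin_ext g x.
Proof.
rewrite /lin_ext scaler_sumr -big_split /=; apply: eq_bigr => i _.
by rewrite scalerDr !scalerA mulrC.
Qed.

Lemma malg_ind (P : {malg K[I]} -> Prop) : P 0 ->
  (forall a i x, P x -> P (a *: << i >> + x)) -> forall x, P x.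
Proof.
move=> P0 PD x; rewrite (monalgE x).
elim: (enum_fset _) => [|i s IHs]; first by rewrite big_nil.
rewrite big_cons; set y := \sum_(_ <- _) _ in IHs *.
have -> : << x@_i *g i >> = x@_i *: << i >> :> {malg K[I]}.
  by apply/malgP => j; rewrite mcoeffZ !mcoeffU mulr_natr.
exact: PD.
Qed.

End LinearExtension.

Section StructureConstants.
Variables (K : fieldType) (I : choiceType) (br : I -> I -> {malg K[I]}).

Definition bilin_ext (x y : {malg K[I]}) : {malg K[I]} :=
  lin_ext (fun i => lin_ext (br i) y) x.

Lemma bilin_ext_linearl z : linear (bilin_ext^~ z).
Proof. exact: lin_ext_is_linear. Qed.

Lemma bilin_ext_linearr z : linear (bilin_ext z).
Proof.
move=> a x y; rewrite /bilin_ext -lin_ext_comb.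
by apply: eq_lin_ext => i; rewrite linearP.
Qed.

Lemma bilin_ext0l z : bilin_ext 0 z = 0.
Proof. exact: linear0. Qed.

Lemma bilin_ext0r z : bilin_ext z 0 = 0.
Proof. by have := bilin_ext_linearr z (-1) 0 0; rewrite !scaleN1r !addNr. Qed.

Lemma bilin_extU i j : bilin_ext << i >> << j >> = br i j.
Proof. by rewrite /bilin_ext lin_extU scale1r lin_extU scale1r. Qed.

Hypothesis br_alt : forall i, br i i = 0.
Hypothesis br_skew : forall i j, br i j = - br j i.
Hypothesis br_jacobi : forall i j k,
  bilin_ext << i >> (br j k) + bilin_ext << j >> (br k i)
    + bilin_ext << k >> (br i j) = 0.

Let extPl a x y z : bilin_ext (a *: x + y) z =
  a *: bilin_ext x z + bilin_ext y z.
Proof. exact: bilin_ext_linearl. Qed.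

Let extPr a x y z : bilin_ext z (a *: x + y) =
  a *: bilin_ext z x + bilin_ext z y.
Proof. exact: bilin_ext_linearr. Qed.

Lemma bilin_extUD a b i j k :
  bilin_ext << i >> (a *: << j >> + b *: << k >>) = a *: br i j + b *: br i k.
Proof.
rewrite extPr bilin_extU; congr (_ + _).
by have := extPr b << k >> 0 << i >>; rewrite bilin_ext0r !addr0 bilin_extU.
Qed.

Lemma bilin_ext_skew x y : bilin_ext x y = - bilin_ext y x.
Proof.
elim/malg_ind: x => [|a i x IHx].
  by rewrite bilin_ext0l bilin_ext0r oppr0.
rewrite extPl extPr IHx opprD -scalerN; congr (_ *: _ + _).
elim/malg_ind: y {IHx} => [|b j y IHy].
  by rewrite bilin_ext0l bilin_ext0r oppr0.
by rewrite extPl extPr IHy opprD -scalerN !bilin_extU br_skew.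
Qed.

Lemma bilin_ext_alt x : bilin_ext x x = 0.
Proof.
elim/malg_ind: x => [|a i x IHx]; first by rewrite bilin_ext0l.
rewrite extPl (extPr a << i >> x << i >>) (extPr a << i >> x x) IHx addr0.
rewrite bilin_extU br_alt scaler0 add0r.
by rewrite (bilin_ext_skew x) scalerN subrr.
Qed.

Let jac x y z := bilin_ext x (bilin_ext y z) + bilin_ext y (bilin_ext z x)
    + bilin_ext z (bilin_ext x y).

Let jac_cycle x y z : jac x y z = jac y z x.
Proof. by rewrite /jac [RHS]addrC addrA. Qed.

Let jac_linearl y z : linear (fun x => jac x y z).
Proof.
move=> a x x'; rewrite /jac (extPl a x x' (bilin_ext y z)).
rewrite (extPr a x x' z) (extPl a x x' y) !extPr !scalerDr.
by rewrite [RHS]addrACA; congr (_ + _); rewrite [RHS]addrACA.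
Qed.

Let jac_ind y z : (forall i, jac << i >> y z = 0) -> forall x, jac x y z = 0.
Proof.
move=> jac0; elim/malg_ind=> [|a i x IHx].
  by rewrite /jac !(bilin_ext0l, bilin_ext0r) !addr0.
by rewrite jac_linearl jac0 IHx scaler0 addr0.
Qed.

Lemma bilin_ext_jacobi x y z :
  bilin_ext x (bilin_ext y z) + bilin_ext y (bilin_ext z x)
    + bilin_ext z (bilin_ext x y) = 0.
Proof.
apply: (jac_ind _ x) => i; rewrite jac_cycle; apply: (jac_ind _ y) => j.
rewrite jac_cycle; apply: (jac_ind _ z) => k.
by rewrite jac_cycle /jac !bilin_extU br_jacobi.
Qed.

End StructureConstants.

Section Cocycle.
Variable K : fieldType.

Definition vir_cocycle (m n : int) : K :=
  if m + n == 0 then (m ^+ 3 - m)%:~R / 12%:R else 0.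

Lemma vir_cocyclexx m : vir_cocycle m m = 0.
Proof.
rewrite /vir_cocycle; case: eqP => // /eqP.
by rewrite -mulr2n mulrn_eq0 /= => /eqP ->; rewrite expr0n subrr mul0r.
Qed.

Lemma vir_cocycleC m n : vir_cocycle m n = - vir_cocycle n m.
Proof.
rewrite /vir_cocycle addrC; case: eqP => [/eqP|_]; last by rewrite oppr0.
rewrite addr_eq0 => /eqP ->; rewrite -mulNr -rmorphN /=; congr (_%:~R / _).
ring.
Qed.

Lemma vir_cocycle_jacobi l m n :
  (m - n)%:~R * vir_cocycle l (m + n) + (n - l)%:~R * vir_cocycle m (n + l)
    + (l - m)%:~R * vir_cocycle n (l + m) = 0.
Proof.
rewrite /vir_cocycle addrA (addrC n l) (addrA m) (addrC m l) (addrC n (l + m)).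
case: eqP => [/eqP|_]; last by rewrite !mulr0 !addr0.
rewrite addrC addr_eq0 => /eqP ->.
rewrite !mulrA -!mulrDl -!rmorphM -!rmorphD /= [X in X%:~R](_ : _ = 0).
  by rewrite mul0r.
ring.
Qed.

Lemma vir_jacobi (V : lmodType K) (l m n : int) (e : int -> V) (c : V) :
  let t l m n := (m - n)%:~R *:
    ((l - (m + n))%:~R *: e (l + (m + n)) + vir_cocycle l (m + n) *: c) in
  t l m n + t m n l + t n l m = 0.
Proof.
rewrite /= (_ : m + (n + l) = l + (m + n)); last by ring.
rewrite (_ : n + (l + m) = l + (m + n)); last by ring.
have combine (a1 a2 a3 b1 b2 b3 : K) (u v : V) :
    a1 *: u + b1 *: v + (a2 *: u + b2 *: v) + (a3 *: u + b3 *: v)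
    = (a1 + a2 + a3) *: u + (b1 + b2 + b3) *: v.
  by rewrite !scalerDl [RHS]addrACA; congr (_ + _); rewrite [RHS]addrACA.
rewrite !scalerDr !scalerA combine.
rewrite vir_cocycle_jacobi scale0r addr0 -!rmorphM -!rmorphD /=.
by rewrite [X in X%:~R](_ : _ = 0) ?scale0r //; ring.
Qed.

End Cocycle.

(* The index [Some m] stands for L_m and [None] for c. *)
Definition vir_br (K : fieldType) (i j : option int) : {malg K[option int]} :=
  match i, j with
  | Some m, Some n =>
      (m - n)%:~R *: << Some (m + n) >> + vir_cocycle K m n *: << None >>
  | _, _ => 0
  end.

(* [Some (inl m)] stands for L_m, [Some (inr m)] for H_m and [None] for c. *)
Definition w22_br (K : fieldType) (i j : option (int + int)) :
    {malg K[option (int + int)]} :=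
  match i, j with
  | Some (inl m), Some (inl n) =>
      (m - n)%:~R *: << Some (inl (m + n)) >> + vir_cocycle K m n *: << None >>
  | Some (inl m), Some (inr n) =>
      (m - n)%:~R *: << Some (inr (m + n)) >> + vir_cocycle K m n *: << None >>
  | Some (inr m), Some (inl n) =>
      - ((n - m)%:~R *: << Some (inr (n + m)) >>
         + vir_cocycle K n m *: << None >>)
  | _, _ => 0
  end.

Section Virasoro.
Variable K : fieldType.

Lemma vir_br_alt i : vir_br K i i = 0.
Proof. by case: i => //= m; rewrite subrr vir_cocyclexx !scale0r addr0. Qed.

Lemma vir_br_skew i j : vir_br K i j = - vir_br K j i.
Proof.
case: i j => [m|] [n|] //=; rewrite ?oppr0 //.
rewrite opprD -!scaleNr -vir_cocycleC -rmorphN /= opprB.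
by rewrite (addrC m n).
Qed.

Lemma vir_br_jacobi i j k :
  bilin_ext (vir_br K) << i >> (vir_br K j k)
    + bilin_ext (vir_br K) << j >> (vir_br K k i)
    + bilin_ext (vir_br K) << k >> (vir_br K i j) = 0.
Proof.
pose t l m n : {malg K[option int]} := (m - n)%:~R *:
  ((l - (m + n))%:~R *: << Some (l + (m + n)) >>
   + vir_cocycle K l (m + n) *: << None >>).
have extE i' j' k' : bilin_ext (vir_br K) << i' >> (vir_br K j' k') =
    if (i', j', k') is (Some l, Some m, Some n) then t l m n else 0.
  case: j' k' => [m|] [n|]; [|by rewrite /= bilin_ext0r; case: i'..].
  rewrite bilin_extUD; case: i' => [l|] /=; first by rewrite scaler0 addr0.
  by rewrite !scaler0 addr0.
rewrite !extE; case: i j k => [l|] [m|] [n|]; rewrite ?addr0 //.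
exact: (vir_jacobi l m n (fun k => << Some k >>)).
Qed.

Definition Vir : Type := {malg K[option int]}.

HB.instance Definition _ := GRing.Lmodule.on Vir.

HB.instance Definition _ := Lmodule_isLie.Build K Vir
  (bilin_ext_linearl (vir_br K)) (bilin_ext_linearr (vir_br K))
  (bilin_ext_alt vir_br_alt vir_br_skew) (bilin_ext_jacobi vir_br_jacobi).

Definition vL (m : int) : Vir := << Some m >>.
Definition vc : Vir := << None >>.

Lemma vir_LL m n :
  [lie vL m, vL n] = (m - n)%:~R *: vL (m + n) + vir_cocycle K m n *: vc.
Proof. exact: bilin_extU. Qed.

Lemma vir_central x : [lie x, vc] = 0.
Proof.
elim/malg_ind: x => [|a i x IHx]; first exact: bilin_ext0l.
rewrite [LHS](bilin_ext_linearl (vir_br K)) [X in _ + X]IHx addr0.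
by rewrite bilin_extU; case: i => [m|]; rewrite scaler0.
Qed.

End Virasoro.

Section W22.
Variable K : fieldType.

Lemma w22_br_alt i : w22_br K i i = 0.
Proof.
by case: i => [[m|m]|] //=; rewrite subrr vir_cocyclexx !scale0r addr0.
Qed.

Lemma w22_br_skew i j : w22_br K i j = - w22_br K j i.
Proof.
case: i j => [[m|m]|] [[n|n]|] //=; rewrite ?oppr0 ?opprK //.
rewrite opprD -!scaleNr -vir_cocycleC -rmorphN /= opprB.
by rewrite (addrC m n).
Qed.

Lemma w22_br_HL m n : w22_br K (Some (inr m)) (Some (inl n)) =
  (m - n)%:~R *: << Some (inr (m + n)) >> + vir_cocycle K m n *: << None >>.
Proof.
rewrite /= opprD -!scaleNr -vir_cocycleC -rmorphN /= opprB.
by rewrite (addrC m n).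
Qed.

Lemma w22_br_jacobi i j k :
  bilin_ext (w22_br K) << i >> (w22_br K j k)
    + bilin_ext (w22_br K) << j >> (w22_br K k i)
    + bilin_ext (w22_br K) << k >> (w22_br K i j) = 0.
Proof.
pose t (e : int -> int + int) l m n : {malg K[option (int + int)]} :=
  (m - n)%:~R *: ((l - (m + n))%:~R *: << Some (e (l + (m + n))) >>
                  + vir_cocycle K l (m + n) *: << None >>).
have extE i' j' k' : bilin_ext (w22_br K) << i' >> (w22_br K j' k') =
    match i', j', k' with
    | Some (inl l), Some (inl m), Some (inl n) => t inl l m n
    | Some (inl l), Some (inl m), Some (inr n)
    | Some (inl l), Some (inr m), Some (inl n)
    | Some (inr l), Some (inl m), Some (inl n) => t inr l m n
    | _, _, _ => 0
    end.
  case: j' => [[m|m]|]; last by rewrite /= bilin_ext0r; case: i' => [[]|].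
    case: k' => [[n|n]|]; last by rewrite /= bilin_ext0r; case: i' => [[]|].
      rewrite bilin_extUD; case: i' => [[l|l]|].
      - by rewrite [w22_br K _ None]/= scaler0 addr0.
      - by rewrite w22_br_HL [w22_br K _ None]/= scaler0 addr0.
      - by rewrite /= !scaler0 addr0.
    rewrite bilin_extUD; case: i' => [[l|l]|]; rewrite [w22_br K _ None]/=.
    - by rewrite scaler0 addr0.
    - by rewrite /= !scaler0 addr0.
    - by rewrite /= !scaler0 addr0.
  case: k' => [[n|n]|]; try by rewrite /= bilin_ext0r; case: i' => [[]|].
  rewrite w22_br_HL bilin_extUD.
  case: i' => [[l|l]|]; rewrite [w22_br K _ None]/=.
  - by rewrite scaler0 addr0.
  - by rewrite /= !scaler0 addr0.
  - by rewrite /= !scaler0 addr0.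
rewrite !extE; case: i j k => [[l|l]|] [[m|m]|] [[n|n]|]; rewrite ?addr0 //.
- exact: (vir_jacobi l m n (fun k => << Some (inl k) >>)).
- exact: (vir_jacobi l m n (fun k => << Some (inr k) >>)).
- exact: (vir_jacobi l m n (fun k => << Some (inr k) >>)).
- exact: (vir_jacobi l m n (fun k => << Some (inr k) >>)).
Qed.

Definition W22 : Type := {malg K[option (int + int)]}.

HB.instance Definition _ := GRing.Lmodule.on W22.

HB.instance Definition _ := Lmodule_isLie.Build K W22
  (bilin_ext_linearl (w22_br K)) (bilin_ext_linearr (w22_br K))
  (bilin_ext_alt w22_br_alt w22_br_skew) (bilin_ext_jacobi w22_br_jacobi).

Definition wL (m : int) : W22 := << Some (inl m) >>.
Definition wH (m : int) : W22 := << Some (inr m) >>.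
Definition wc : W22 := << None >>.

Lemma w22_LL m n :
  [lie wL m, wL n] = (m - n)%:~R *: wL (m + n) + vir_cocycle K m n *: wc.
Proof. exact: bilin_extU. Qed.

Lemma w22_LH m n :
  [lie wL m, wH n] = (m - n)%:~R *: wH (m + n) + vir_cocycle K m n *: wc.
Proof. exact: bilin_extU. Qed.

Lemma w22_HH m n : [lie wH m, wH n] = 0.
Proof. exact: bilin_extU. Qed.

Lemma w22_central x : [lie x, wc] = 0.
Proof.
elim/malg_ind: x => [|a i x IHx]; first exact: bilin_ext0l.
rewrite [LHS](bilin_ext_linearl (w22_br K)) [X in _ + X]IHx addr0.
by rewrite bilin_extU; case: i => [[m|m]|]; rewrite scaler0.
Qed.

End W22.

(* Main.v *)
From HB Require Import structures.
Require Import Defs.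
From mathcomp Require Import all_boot all_order all_algebra.
From mathcomp Require Import finmap monalg complex reals ring zify.
Import GRing.Theory Num.Theory.

Set Implicit Arguments.
Unset Strict Implicit.
Unset Printing Implicit Defensive.

Local Open Scope ring_scope.

(** A commutative product whose left multiplications are derivations is a
    symmetric biderivation, and the theorem holds because the Virasoro algebra
    and W(2,2) have no nonzero symmetric biderivation.

    Since ad L_0 is diagonal modulo the centre, the coefficients of a
    biderivation split by total degree: for fixed s, let T m n be the
    coefficient of dot (L_m) (L_n) in degree m + n + s.  As a function of n,
    T m is a degree s + m derivation of the Witt algebra, and T is symmetric.
    The derivation rule applied to the bracket of L_0 and L_n expresses T m n
    through T m 0, the same rule in the other argument expresses it through
    T 0 n, and comparing the two leaves at most one nonzero entry of T.  A Witt
    derivation cannot be supported at one point ([witt_derivation_one_point]),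
    so T vanishes ([witt_symmetric_biderivation]) and dot (L_m) (L_n) is
    central.

    In W(2,2), bracketing with L_n acts in the same way on the L-coefficients
    and on the H-coefficients, so the same argument applies to both.  Once
    dot (L_p) (L_0) is central, dot (L_p) (H_m) must be an eigenvector of ad L_0
    of degree m; hence each homogeneous component of the derivation sending L_n
    to dot (H_m) (L_n) is supported at one n, and vanishes.  Then dot (H_m)
    commutes with every ad L_p on the H_n, which by symmetry forces
    dot (H_m) (H_n) to be central too.

    Finally, a biderivation with central values kills all brackets
    ([biderivation_central_brackets]), and both algebras are spanned by
    brackets. *)

(** * Coefficients of Witt derivations and symmetric biderivations *)

Lemma intr_mulf_eq0 (K : numFieldType) (z : int) (x : K) :
  z != 0 -> z%:~R * x = 0 -> x = 0.
Proof. by move=> z0 /eqP; rewrite mulf_eq0 intr_eq0 (negPf z0) => /eqP. Qed.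

(** The derivation rule, applied to the bracket of L_p and L_n, for the linear
    map sending L_n to A n times L_(n + d). *)
Definition witt_derivation (K : numFieldType) (d : int) (A : int -> K) : Prop :=
  forall p n, (p - n)%:~R * A (p + n)
    = (d + p - n)%:~R * A p + (p - n - d)%:~R * A n.

(** For q != 0, the rules for the pairs (-q, q) and (-2q, q) involve no other
    point of the support: they give two multiples of A q that vanish, and the
    difference of these multiples is q A q.  For q = 0, the pair (1, -1) gives
    2 A 0 = 0. *)
Lemma witt_derivation_one_point (K : numFieldType) (d q : int) (A : int -> K) :
  witt_derivation d A -> (forall n, n != q -> A n = 0) -> forall n, A n = 0.
Proof.
move=> hA A0 n; case: (eqVneq n q) => [->|/A0 //].
case: (eqVneq q 0) => [q0|nz_q].
  have := hA 1 (-1); rewrite (A0 1) ?(A0 (-1)) ?q0 // !mulr0 addr0.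
  exact: intr_mulf_eq0.
have far k : k != 1 -> A (k * q) = 0.
  move=> k1; apply: A0.
  by rewrite -subr_eq0 -{2}[q]mul1r -mulrBl mulf_neq0 ?subr_eq0.
have e1 := hA (-1 * q) q; have e2 := hA (-2 * q) q.
rewrite (_ : -1 * q + q = 0 * q) ?far // in e1; last by ring.
rewrite (_ : -2 * q + q = -1 * q) ?far // in e2; last by ring.
apply: (@intr_mulf_eq0 _ q) => //.
rewrite !mulr0 add0r in e1; rewrite !mulr0 add0r in e2.
have -> : q%:~R * A q = (-1 * q - q - d)%:~R * A q - (-2 * q - q - d)%:~R * A q.
  by ring.
by rewrite -e1 -e2 subrr.
Qed.

(** The rule for the pair (0, n) reads (s + m) T m n = (s + m - n) T m 0, so
    everything reduces to the row T 0.  For s = 0, symmetry turns this into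
    n T 0 m = - m T 0 n for distinct m and n, and going around three distinct
    indices changes the sign of T 0 n.  For s != 0, the right-hand side is zero
    at (s, 2s), and T s 2s = 0 propagates to T 0 0 and then to all of T 0.
    What is left is the row m = - s, supported at n = - s. *)
Lemma witt_symmetric_biderivation (K : numFieldType) (s : int)
    (T : int -> int -> K) :
  (forall m n, T m n = T n m) ->
  (forall m, witt_derivation (s + m) (T m)) ->
  forall m n, T m n = 0.
Proof.
move=> TC hT.
have T0 m n : (s + m)%:~R * T m n = (s + m - n)%:~R * T m 0.
  have := hT m 0 n; rewrite (add0r n) addr0 => e.
  have -> : (s + m)%:~R * T m n = (0 - n)%:~R * T m n
    - (0 - n - (s + m))%:~R * T m n by ring.
  by rewrite e addrK.
have row0 : forall n, T 0 n = 0.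
  case: (eqVneq s 0) => [s0|nz_s].
    have T00 : T 0 0 = 0.
      apply: (@intr_mulf_eq0 _ (- 1)) => //.
      by have := T0 0 1; rewrite s0 mul0r => ->.
    have Tn m n : m != n -> n%:~R * T 0 m = - (m%:~R * T 0 n).
      move=> neq; apply/eqP; rewrite -addr_eq0; apply/eqP.
      apply: (@intr_mulf_eq0 _ (m - n)); first by rewrite subr_eq0.
      have := T0 m n; have := T0 n m; rewrite s0 !add0r !(TC _ 0) (TC n m).
      move=> e1 e2.
      have -> : (m - n)%:~R * (n%:~R * T 0 m + m%:~R * T 0 n)
        = n%:~R * ((m - n)%:~R * T 0 m) - m%:~R * ((n - m)%:~R * T 0 n) by ring.
      rewrite -e1 -e2; ring.
    move=> n; case: (eqVneq n 0) => [->//|nz_n].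
    have e1 := Tn n (n *+ 2); have e2 := Tn n (n *+ 3).
    have e3 := Tn (n *+ 2) (n *+ 3).
    apply: (@intr_mulf_eq0 _ (12 * n * n)); first by lia.
    have -> : (12 * n * n)%:~R * T 0 n =
       (n *+ 3)%:~R * ((n *+ 2)%:~R * T 0 n)
       + (n *+ 2)%:~R * ((n *+ 3)%:~R * T 0 n) by ring.
    rewrite e1 ?e2; try lia.
    have -> : (n *+ 3)%:~R * - (n%:~R * T 0 (n *+ 2)) =
       - (n%:~R * ((n *+ 3)%:~R * T 0 (n *+ 2))) by ring.
    by rewrite e3; [ring | lia].
  (* These carry the vanishing from T s 2s to T 2s 0 and then to T 0 0. *)
  have e1 := T0 s (s + s); have e2 := T0 (s + s) s.
  have e3 := T0 0 (s + s).
  rewrite subrr mul0r in e1.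
  move/intr_mulf_eq0: e1 => e1.
  rewrite (TC _ s) e1 ?mulr0 in e2; last lia.
  move/esym/intr_mulf_eq0: e2 => e2.
  rewrite TC e2 ?mulr0 in e3; last lia.
  move/esym/intr_mulf_eq0: e3 => e3.
  move=> n; apply: (@intr_mulf_eq0 _ s) => //.
  have := T0 0 n; rewrite e3; last lia.
  by rewrite addr0 mulr0.
have T0' m n : (s + m)%:~R * T m n = 0.
  by rewrite T0 TC row0 mulr0.
have off m n : m != - s -> T m n = 0.
  by move=> ms; apply: (@intr_mulf_eq0 _ (s + m)) (T0' m n); lia.
move=> m; case: (eqVneq m (- s)) => [->|/off//].
apply: (@witt_derivation_one_point _ (s + - s) (- s)) (hT _) _ => n /off.
by rewrite TC.
Qed.

(** * Biderivations of Lie algebras containing the Virasoro relations *)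

Section WittFrames.
Variables (K : numFieldType) (g : lieAlgType K).
Implicit Types (x y z : g) (dot : {bilinear g -> g -> g}).

Definition central x := forall y, [lie x, y] = 0.

Definition symmetric_biderivation dot :=
  (forall x y, dot x y = dot y x) /\
  (forall x y z, dot x [lie y, z] = [lie dot x y, z] + [lie y, dot x z]).

Lemma lieC x y : [lie x, y] = - [lie y, x].
Proof.
have := liexx (x + y); rewrite linearDl !linearDr /= !liexx add0r addr0.
by move/eqP; rewrite addr_eq0 => /eqP.
Qed.

Lemma centralP a x y : central x -> central y -> central (a *: x + y).
Proof.
by move=> hx hy z; rewrite linearDl linearZl_LR /= hx hy scaler0 addr0.
Qed.

Lemma central_lier x : central x -> forall y, [lie y, x] = 0.
Proof. by move=> hx y; rewrite lieC hx oppr0. Qed.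

(** The term dot x z commutes with everything since derivations preserve the
    centre. *)
Lemma biderivation_central dot x z :
  symmetric_biderivation dot -> central z -> central (dot x z).
Proof.
move=> [_ dotD] hz y; have := dotD x z y.
by rewrite !hz addr0 linear0r.
Qed.

(** With X := L these are the relations of the Virasoro algebra; with X := H
    they are the mixed relations of W(2,2). *)
Definition witt_family (L X : int -> g) (c : g) := forall m n,
  [lie L m, X n] = (m - n)%:~R *: X (m + n) + vir_cocycle K m n *: c.

(** The form e k behaves as a coefficient in degree k that ignores the central
    term: in W(2,2) both the coefficient of L_k and that of H_k qualify. *)
Definition witt_coord (L : int -> g) (e : int -> {scalar g}) :=
  forall k n x, e (k + n) [lie x, L n] = (k - n)%:~R * e k x.

Lemma vir_cocycle0 n : vir_cocycle K 0 n = 0.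
Proof. by rewrite /vir_cocycle expr0n subrr mul0r if_same. Qed.

Lemma vir_cocycle1 : vir_cocycle K 1 (- 1) = 0.
Proof. by rewrite /vir_cocycle expr1n !subrr eqxx mul0r. Qed.

Lemma witt_family_eigen L X c n :
  witt_family L X c -> [lie L 0, X n] = - n%:~R *: X n.
Proof.
by move=> LX; rewrite LX vir_cocycle0 scale0r addr0 sub0r add0r rmorphN.
Qed.

(** The brackets of L_0 with X_n, and that of L_1 with X_(-1) for n = 0, are
    nonzero multiples of X_n without central term. *)
Lemma witt_family_bracket (V : lmodType K) (phi : {linear g -> V}) L X c :
  witt_family L X c -> (forall x y, phi [lie x, y] = 0) ->
  forall n, phi (X n) = 0.
Proof.
move=> LX phi0 n; case: (eqVneq n 0) => [->|nz_n].
  have := phi0 (L 1) (X (- 1)); rewrite LX vir_cocycle1 scale0r addr0.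
  rewrite subrr opprK linearZ => /eqP; rewrite scaler_eq0 intr_eq0 /=.
  by move=> /eqP.
have := phi0 (L 0) (X n); rewrite (witt_family_eigen _ LX).
rewrite linearZ => /eqP.
by rewrite scaler_eq0 oppr_eq0 intr_eq0 (negPf nz_n) => /eqP.
Qed.

(** Bracketing a central x with L_(k - 1) multiplies e k x by k - (k - 1) = 1. *)
Lemma witt_coord_central L e k x : witt_coord L e -> central x -> e k x = 0.
Proof.
move=> eL hx; have := eL k (k - 1) x; rewrite hx linear0 opprB addrCA subrr.
by rewrite addr0 mul1r.
Qed.

Lemma witt_coord_lier L e k n x : witt_coord L e ->
  e (k + n) [lie L n, x] = (n - k)%:~R * e k x.
Proof. by move=> eL; rewrite lieC linearN eL -mulNr -rmorphN /= opprB. Qed.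

(** The central term of the bracket of L_p and L_n disappears because dot x c is
    central, hence has no coordinates. *)
Lemma biderivation_coord dot L c e x d :
  symmetric_biderivation dot -> central c -> witt_family L L c ->
  witt_coord L e -> witt_derivation d (fun n => e (n + d) (dot x (L n))).
Proof.
move=> hdot hc LL eL p n; have [_ dotD] := hdot.
have := dotD x (L p) (L n); rewrite LL linearDr !linearZr_LR.
move/(congr1 (e (p + n + d))); rewrite !linearD !linearZ /=.
rewrite (witt_coord_central _ eL (biderivation_central x hdot hc)) mulr0 addr0.
have e1 := eL (p + d) n (dot x (L p)); rewrite addrAC in e1.
have e2 := witt_coord_lier (n + d) p (dot x (L n)) eL.
rewrite addrC addrA in e2; rewrite e1 e2 => ->.
by congr (_%:~R * _ + _%:~R * _); ring.
Qed.

Lemma witt_coord_eigen L e k m x : witt_coord L e ->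
  [lie L 0, x] = - m%:~R *: x -> k != m -> e k x = 0.
Proof.
move=> eL hx km; have := witt_coord_lier k 0 x eL.
rewrite hx addr0 linearZ /= => h; apply: (@intr_mulf_eq0 _ (k - m)).
  by rewrite subr_eq0.
have -> : (k - m)%:~R * e k x
  = - m%:~R * e k x - (0 - k)%:~R * e k x by ring.
by rewrite h subrr.
Qed.

(** Several families of coordinates, indexed by J, that together recognise
    central elements. *)
Record witt_frame (L : int -> g) (c : g) (J : Type)
    (e : J -> int -> {scalar g}) : Prop := WittFrame {
  frame_central : central c;
  frame_LL : witt_family L L c;
  frame_coord : forall j, witt_coord L (e j);
  frame_detect : forall x, (forall j k, e j k x = 0) -> central x
}.

Section FrameBiderivation.
Variables (L X : int -> g) (c : g) (J : Type) (e : J -> int -> {scalar g}).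
Variable dot : {bilinear g -> g -> g}.
Hypotheses (hL : witt_frame L c e) (LX : witt_family L X c).
Hypothesis hdot : symmetric_biderivation dot.

Let dotC := proj1 hdot.
Let dotD := proj2 hdot.

Lemma dot_LL_central m n : central (dot (L m) (L n)).
Proof.
have [hc LL eL detect] := hL; apply: detect => j k.
pose T s m n := e j (n + (s + m)) (dot (L m) (L n)).
have := @witt_symmetric_biderivation _ (k - m - n) (T (k - m - n)) _ _ m n.
rewrite /T (_ : n + (k - m - n + m) = k); last by ring.
apply=> [m' n'|m']; last exact: biderivation_coord hdot hc LL (eL j).
by rewrite dotC; congr (e j _ _); ring.
Qed.

(** As dot (L_p) (L_0) is central, dot (L_p) maps the L_0-eigenvector X_m to an
    eigenvector of the same degree.  Hence dot (X_m) (L_p) has coordinates in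
    degree m only, and for each d the degree d component of the derivation
    sending L_p to dot (X_m) (L_p) is supported at p = m - d. *)
Lemma dot_XL_central m n : central (dot (X m) (L n)).
Proof.
have [hc LL eL detect] := hL; apply: detect => j k.
have := @witt_derivation_one_point K (k - n) (m - (k - n)) _
  (biderivation_coord (X m) (k - n) hdot hc LL (eL j)) _ n.
rewrite addrCA subrr addr0; apply=> p pm.
apply: (@witt_coord_eigen _ _ _ m _ (eL j)); last by lia.
have := dotD (L p) (L 0) (X m).
rewrite (dot_LL_central p 0) add0r (witt_family_eigen _ LX).
by rewrite linearZr_LR /= dotC.
Qed.

(** The map dot (X_q) commutes with ad L_p on the X_r.  For p = 0 this puts
    dot (X_m) (X_n) in degree n, and by symmetry in degree m, so only m = n = k
    remains; bracketing with L_p, p distinct from 0 and k, leads to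
    dot (X_k) (X_(p + k)), which vanishes modulo the centre since its two
    degrees differ. *)
Lemma dot_XX_central m n : central (dot (X m) (X n)).
Proof.
have [hc LL eL detect] := hL.
have dotL q r p : dot (X q) [lie L p, X r] = [lie L p, dot (X q) (X r)].
  by rewrite dotD (dot_XL_central q p) add0r.
have eig j k q r : k != r -> e j k (dot (X q) (X r)) = 0.
  apply: witt_coord_eigen (eL j) _.
  by rewrite -dotL (witt_family_eigen _ LX) linearZr_LR.
apply: detect => j k.
case: (eqVneq k n) => [<-|]; last exact: eig.
case: (eqVneq k m) => [<-|]; last by rewrite dotC; apply: eig.
have [p pk p0] : exists2 p, p != k & p != 0.
  by case: (eqVneq k 1) => [->|k1]; [exists 2 | exists 1; rewrite // eq_sym].
apply: (@intr_mulf_eq0 _ (p - k)); first by rewrite subr_eq0.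
rewrite -(witt_coord_lier _ _ _ (eL j)) -dotL LX linearDr !linearZr_LR.
rewrite linearD !linearZ /= dotC eig; last lia.
by rewrite (witt_coord_central _ (eL j) (biderivation_central _ hdot hc))
  !mulr0 addr0.
Qed.

End FrameBiderivation.

Lemma biderivation_central_brackets dot : symmetric_biderivation dot ->
  (forall x y, central (dot x y)) -> forall x y z, dot x [lie y, z] = 0.
Proof.
move=> [_ dotD] hdot x y z.
by rewrite dotD hdot (central_lier (hdot _ _)) addr0.
Qed.

(** The bracket of L_2 and L_(-2) is 4 L_0 + c / 2. *)
Lemma witt_family_bracket_center (V : lmodType K) (phi : {linear g -> V}) L c :
  witt_family L L c -> (forall x y, phi [lie x, y] = 0) -> phi c = 0.
Proof.
move=> LL phi0; have := phi0 (L 2) (L (- 2)); rewrite LL linearD !linearZ /=.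
rewrite (witt_family_bracket LL phi0) scaler0 add0r.
rewrite /vir_cocycle subrr eqxx => /eqP; rewrite scaler_eq0 => /orP[|/eqP//].
by rewrite mulf_eq0 invr_eq0 intr_eq0 pnatr_eq0.
Qed.

End WittFrames.

(** * The Virasoro algebra and W(2,2) *)

(** A single family of coordinates recognises the centre here, hence the index j
    in unit; W(2,2) requires two. *)
Definition vir_coord (K : numFieldType) (j : unit) (k : int) (x : Vir K) : K^o :=
  x@_(Some k).

Lemma vir_coord_linear K j k : linear (@vir_coord K j k).
Proof. by move=> a x y; rewrite /vir_coord mcoeffD mcoeffZ. Qed.

HB.instance Definition _ (K : numFieldType) j k :=
  GRing.isLinear.Build K (Vir K) K^o *:%R (@vir_coord K j k)
    (@vir_coord_linear K j k).

Lemma vir_frame (K : numFieldType) :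
  witt_frame (@vL K) (vc K) (fun j k => @vir_coord K j k).
Proof.
split=> [x|m n|j k n x|x x0].
- by rewrite lieC vir_central oppr0.
- exact: vir_LL.
- elim/malg_ind: x => [|a i x IHx]; first by rewrite linear0l !linear0 mulr0.
  rewrite linearPl !linearP /= IHx mulrDr; congr (_ + _).
  rewrite mulrCA /vir_coord; congr (_ * _); rewrite mcoeffU; case: i => [m|].
    rewrite vir_LL mcoeffD !mcoeffZ !mcoeffU mulr0 addr0.
    rewrite !(inj_eq Some_inj) (inj_eq (addIr n)).
    by case: eqVneq => [->|]; rewrite ?mulr0.
  by rewrite -/(vc K) lieC vir_central oppr0 mcoeff0 mulr0.
- have -> : x = x@_None *: vc K.
    apply/malgP => -[k|]; rewrite mcoeffZ mcoeffU ?mulr1 // mulr0.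
    exact: (x0 tt).
  by move=> y; rewrite lieC linearZr_LR /= vir_central scaler0 oppr0.
Qed.

Definition w22_coord (K : numFieldType) (j : bool) (k : int) (x : W22 K) : K^o :=
  x@_(Some (if j then inl k else inr k)).

Lemma w22_coord_linear K j k : linear (@w22_coord K j k).
Proof. by move=> a x y; rewrite /w22_coord mcoeffD mcoeffZ. Qed.

HB.instance Definition _ (K : numFieldType) j k :=
  GRing.isLinear.Build K (W22 K) K^o *:%R (@w22_coord K j k)
    (@w22_coord_linear K j k).

Lemma w22_frame (K : numFieldType) :
  witt_frame (@wL K) (wc K) (fun j k => @w22_coord K j k).
Proof.
split=> [x|m n|j k n x|x x0].
- by rewrite lieC w22_central oppr0.
- exact: w22_LL.
- elim/malg_ind: x => [|a i x IHx]; first by rewrite linear0l !linear0 mulr0.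
  rewrite linearPl !linearP /= {}IHx mulrDr; congr (_ + _).
  rewrite mulrCA /w22_coord; congr (_ * _); rewrite mcoeffU; case: i => [[m|m]|].
  + rewrite w22_LL mcoeffD !mcoeffZ !mcoeffU mulr0 addr0.
    case: j; rewrite !(inj_eq Some_inj) ?mulr0 //.
    rewrite !(inj_eq inl_inj) (inj_eq (addIr n)).
    by case: eqVneq => [->|]; rewrite ?mulr0.
  + rewrite lieC w22_LH mcoeffN mcoeffD !mcoeffZ !mcoeffU mulr0 addr0.
    case: j; rewrite !(inj_eq Some_inj) ?mulr0 ?oppr0 //.
    rewrite !(inj_eq inr_inj) (addrC n m) (inj_eq (addIr n)).
    case: eqVneq => [->|]; rewrite ?mulr0 ?oppr0 //.
    by rewrite -mulNr -rmorphN opprB.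
  + by rewrite -/(wc K) lieC w22_central oppr0 mcoeff0 mulr0.
- have -> : x = x@_None *: wc K.
    apply/malgP => -[[k|k]|]; rewrite mcoeffZ mcoeffU ?mulr1 // mulr0.
      exact: (x0 true).
    exact: (x0 false).
  by move=> y; rewrite lieC linearZr_LR /= w22_central scaler0 oppr0.
Qed.

Lemma vir_basis_ind (K : numFieldType) (P : Vir K -> Prop) :
  P 0 -> (forall a x y, P x -> P y -> P (a *: x + y)) ->
  (forall n, P (vL K n)) -> P (vc K) -> forall x, P x.
Proof.
move=> P0 PD PL Pc; elim/malg_ind=> // a [m|] x Px; first exact: PD (PL m) Px.
exact: PD Pc Px.
Qed.

Lemma w22_basis_ind (K : numFieldType) (P : W22 K -> Prop) :
  P 0 -> (forall a x y, P x -> P y -> P (a *: x + y)) ->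
  (forall n, P (wL K n)) -> (forall n, P (wH K n)) -> P (wc K) -> forall x, P x.
Proof.
move=> P0 PD PL PH Pc; elim/malg_ind=> // a [[m|m]|] x Px.
- exact: PD (PL m) Px.
- exact: PD (PH m) Px.
- exact: PD Pc Px.
Qed.

Lemma vir_biderivation_trivial (K : numFieldType)
    (dot : {bilinear Vir K -> Vir K -> Vir K}) :
  symmetric_biderivation dot -> forall x y, dot x y = 0.
Proof.
move=> hdot; have [dotC _] := hdot; have fr := vir_frame K.
have centc := frame_central fr.
have dotc x : central (dot x (vc K)) by apply: biderivation_central.
have cent0 : central (0 : Vir K) by move=> z; rewrite linear0l.
have cent x y : central (dot x y).
  elim/vir_basis_ind: y => [|a y z hy hz|n|]; last exact: dotc.
  - by rewrite linear0r.
  - by rewrite linearPr; apply: centralP.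
  elim/vir_basis_ind: x => [|a y z hy hz|m|]; last by rewrite dotC.
  - by rewrite linear0l.
  - by rewrite linearPl; apply: centralP.
  exact: (dot_LL_central fr hdot m n).
have br := biderivation_central_brackets hdot cent.
move=> x; elim/vir_basis_ind=> [|a y z hy hz|n|].
- by rewrite linear0r.
- by rewrite linearPr hy hz scaler0 addr0.
- exact: witt_family_bracket (frame_LL fr) (br x) n.
- exact: witt_family_bracket_center (frame_LL fr) (br x).
Qed.

Lemma w22_biderivation_trivial (K : numFieldType)
    (dot : {bilinear W22 K -> W22 K -> W22 K}) :
  symmetric_biderivation dot -> forall x y, dot x y = 0.
Proof.
move=> hdot; have [dotC _] := hdot; have fr := w22_frame K.
have centc := frame_central fr.
have LH : witt_family (@wL K) (@wH K) (wc K) by exact: w22_LH.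
have dotc x : central (dot x (wc K)) by apply: biderivation_central.
have cent0 : central (0 : W22 K) by move=> z; rewrite linear0l.
have cent x y : central (dot x y).
  elim/w22_basis_ind: y => [|a y z hy hz|n|n|]; last exact: dotc.
  - by rewrite linear0r.
  - by rewrite linearPr; apply: centralP.
  - elim/w22_basis_ind: x => [|a y z hy hz|m|m|]; last by rewrite dotC.
    + by rewrite linear0l.
    + by rewrite linearPl; apply: centralP.
    + exact: (dot_LL_central fr hdot m n).
    + exact: (dot_XL_central fr LH hdot m n).
  - elim/w22_basis_ind: x => [|a y z hy hz|m|m|]; last by rewrite dotC.
    + by rewrite linear0l.
    + by rewrite linearPl; apply: centralP.
    + by rewrite dotC; apply: (dot_XL_central fr LH hdot n m).
    + exact: (dot_XX_central fr LH hdot m n).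
have br := biderivation_central_brackets hdot cent.
move=> x; elim/w22_basis_ind=> [|a y z hy hz|n|n|].
- by rewrite linear0r.
- by rewrite linearPr hy hz scaler0 addr0.
- exact: witt_family_bracket (frame_LL fr) (br x) n.
- exact: witt_family_bracket LH (br x) n.
- exact: witt_family_bracket_center (frame_LL fr) (br x).
Qed.

Theorem theorem4p6 (R : realType) :
  (forall dot : {bilinear Vir R[i] -> Vir R[i] -> Vir R[i]},
     comm_post_lie dot -> forall x y : Vir R[i], dot x y = 0)
  /\
  (forall dot : {bilinear W22 R[i] -> W22 R[i] -> W22 R[i]},
     comm_post_lie dot -> forall x y : W22 R[i], dot x y = 0).
Proof.
split=> dot [dotC _ dotD].
- by apply: vir_biderivation_trivial; split.
- by apply: w22_biderivation_trivial; split.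
Qed.
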